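(* Let $X$ be a real Hilbert space (finite- or infinite-dimensional) and let $\mathcal{C}$ be a nonempty finite collection of nonempty polyhedral subsets of $X$. Let $\lambda\in[0,2[$ and $x_0\in X$. Generate a sequence $(x_n)_{n\in\mathbb{N}}$ as follows: given $x_n$, pick any $R_n\in\mathcal{R}_{\mathcal{C},[0,\lambda]}$ (the choice may depend arbitrarily on $n$ and on the past) and set $x_{n+1}:=R_n x_n$. Then the sequence $(x_n)_{n\in\mathbb{N}}$ is bounded.
   Context: A subset $C$ of $X$ is polyhedral if it is of the form $C=\{x\in X : \langle a_i,x\rangle\le\beta_i \text{ for all } i\in I\}$ for some finite index set $I$, vectors $a_i\in X\setminus\{0\}$ and reals $\beta_i$ (i.e. an intersection of finitely many closed halfspaces). For a nonempty closed convex set $C$, $P_C$ is the orthogonal (nearest-point) projector onto $C$, and $\mathrm{Id}$ is the identity on $X$. For a finite collection $\mathcal{C}$ of nonempty closed convex sets and an interval $\Lambda\subseteq[0,2]$, the set of relaxed projectors is \[ \mathcal{R}_{\mathcal{C},\Lambda}:=\{(1-\mu)\mathrm{Id}+\mu P_C : C\in\mathcal{C},\ \mu\in\Lambda\}. \] *)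

(* Defs.v *)
From HB Require Import structures.
From mathcomp Require Import all_boot all_order all_algebra.
From mathcomp Require Import all_classical all_reals all_analysis.
Set Implicit Arguments. Unset Strict Implicit. Unset Printing Implicit Defensive.
Import Order.TTheory GRing.Theory Num.Theory.
Import numFieldNormedType.Exports.
Local Open Scope classical_set_scope.
Local Open Scope ring_scope.

(* A real Hilbert space is modelled as a complete normed space V over a
   real field R (R : realType) together with an inner product inducing the
   norm. *)
Definition is_inner_product (R : realType) (V : completeNormedModType R)
    (ip : V -> V -> R) : Prop :=
  (forall x y : V, ip x y = ip y x) /\
  (forall (a : R) (x y z : V), ip (a *: x + y) z = a * ip x z + ip y z) /\
  (forall x : V, ip x x = `|x| ^+ 2).

Definition polyhedral (R : realType) (V : completeNormedModType R)
    (ip : V -> V -> R) (C : set V) : Prop :=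
  exists (m : nat) (a : 'I_m -> V) (beta : 'I_m -> R),
    (forall i, a i != 0) /\
    C = [set x | forall i, ip (a i) x <= beta i].

Definition is_proj (R : realType) (V : completeNormedModType R)
    (C : set V) (x p : V) : Prop :=
  C p /\ forall c, C c -> `|x - p| <= `|x - c|.

(* Main.v *)
(* The projection of x onto a polyhedron is also its projection onto the affine
   subspace cut out by the constraints active there, so finitely many affine
   subspaces, parallel to M_T = {v | <a_i,v> = 0 for all i in T}, suffice. A large
   ball need not be invariant under the relaxed projections onto these, but the
   convex body
     {x | <u,x> <= r_|S| |u| for all S and all u in M_S}
   is, for suitable radii r_0 > r_1 > ... : if T is contained in S, the step does
   not change <u,x> for u in M_S; otherwise |S U T| > |S|, and the positive angle
   between M_S and M_T makes the step contract the part of u orthogonal to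
   M_(S U T), while the remaining part only sees the smaller radius r_|S U T|.
   By convexity only the largest relaxation parameter matters. *)
Require Import Defs.
From HB Require Import structures.
From mathcomp Require Import all_boot all_order all_algebra.
From mathcomp Require Import all_classical all_reals all_analysis.
From mathcomp Require Import ring lra.
Import Order.TTheory GRing.Theory Num.Theory.
Import numFieldNormedType.Exports.
Local Open Scope classical_set_scope.
Local Open Scope ring_scope.

(** * Inner product identities and the Cauchy-Schwarz inequality *)

Section InnerProduct.
Context (R : realType) (V : completeNormedModType R) (ip : V -> V -> R).
Context (ip_inner : is_inner_product ip).

Lemma ipC x y : ip x y = ip y x. Proof. exact: ip_inner.1. Qed.

Lemma ipxx x : ip x x = `|x| ^+ 2. Proof. exact: ip_inner.2.2. Qed.

Lemma ipDl x y z : ip (x + y) z = ip x z + ip y z.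
Proof. by rewrite -[x]scale1r ip_inner.2.1 mul1r scale1r. Qed.

Lemma ip0l z : ip 0 z = 0.
Proof. by have := ipDl 0 0 z; rewrite addr0; lra. Qed.

Lemma ipZl a x z : ip (a *: x) z = a * ip x z.
Proof. by rewrite -[a *: x]addr0 ip_inner.2.1 ip0l addr0. Qed.

Lemma ipBl x y z : ip (x - y) z = ip x z - ip y z.
Proof. by rewrite ipDl -scaleN1r ipZl mulN1r. Qed.

Lemma ipDr x y z : ip z (x + y) = ip z x + ip z y.
Proof. by rewrite !(ipC z) ipDl. Qed.

Lemma ipZr a x z : ip z (a *: x) = a * ip z x.
Proof. by rewrite !(ipC z) ipZl. Qed.

Lemma ipBr x y z : ip z (x - y) = ip z x - ip z y.
Proof. by rewrite !(ipC z) ipBl. Qed.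

Lemma norm_sub_scale (x y : V) (t : R) :
  `|x - t *: y| ^+ 2 = `|x| ^+ 2 - 2 * t * ip x y + t ^+ 2 * `|y| ^+ 2.
Proof. rewrite -!ipxx !ipBl !ipBr !ipZl !ipZr (ipC y x); ring. Qed.

Lemma ip_le_norm x y : ip x y <= `|x| * `|y|.
Proof.
have [->|y0] := eqVneq y 0; first by rewrite ipC ip0l normr0 mulr0.
have ny : 0 < `|y| by rewrite normr_gt0.
have := sqr_ge0 `| `|y| *: x - `|x| *: y|.
rewrite norm_sub_scale ipZl normrZ normr_id => h.
have [->|x0] := eqVneq x 0; first by rewrite ip0l normr0 mul0r.
have nx : 0 < `|x| by rewrite normr_gt0.
have xy : 0 < `|x| * `|y| by rewrite mulr_gt0.
by rewrite -(ler_pM2l xy); nra.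
Qed.

Lemma normr_ip_le x y : `|ip x y| <= `|x| * `|y|.
Proof.
rewrite ler_norml ip_le_norm andbT.
by have := ip_le_norm (- x) y; rewrite -scaleN1r ipZl normrZ normrN1; lra.
Qed.

Lemma pythagoras x y : ip x y = 0 -> `|x + y| ^+ 2 = `|x| ^+ 2 + `|y| ^+ 2.
Proof. by move=> xy; rewrite -!ipxx !ipDl !ipDr (ipC y x) xy; ring. Qed.

Lemma ipxx_eq0 x : ip x x = 0 -> x = 0.
Proof. by rewrite ipxx => /eqP; rewrite sqrf_eq0 normr_eq0 => /eqP. Qed.

(** * Optimality conditions for nearest points *)

Lemma is_proj_ip_eq0 (C : set V) (x p v : V) (e : R) :
  is_proj C x p -> 0 < e -> (forall t, `|t| <= e -> C (p + t *: v)) ->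
  ip (x - p) v = 0.
Proof.
move=> [Cp pmin] e0 Cv; apply/eqP/negPn/negP => k0.
set k := ip (x - p) v in k0.
have v0 : 0 < `|v| ^+ 2.
  rewrite exprn_gt0// normr_gt0; apply: contraNneq k0 => v0.
  by rewrite /k v0 ipC ip0l.
have nk : 0 < `|k| by rewrite normr_gt0.
have key t : `|t| <= e -> 2 * t * k <= t ^+ 2 * `|v| ^+ 2.
  move=> /Cv /pmin; rewrite opprD addrA => h.
  have : `|x - p| ^+ 2 <= `|x - p - t *: v| ^+ 2 by rewrite ler_sqr ?nnegrE.
  by rewrite norm_sub_scale -/k; lra.
(* The trial step is [t = s * k]: the first bound makes it admissible, the second keeps the
   quadratic term below [s * k ^+ 2], half of the linear term. *)
pose s := Num.min (e / `|k|) (`|v| ^+ 2)^-1.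
have s0 : 0 < s by rewrite lt_min divr_gt0 //= invr_gt0.
have se : s * `|k| <= e by rewrite -ler_pdivlMr// ge_min lexx.
have sv : s * `|v| ^+ 2 <= 1.
  by rewrite -ler_pdivlMr// mul1r ge_min lexx orbT.
have := key (s * k); rewrite normrM (gtr0_norm s0) => /(_ se).
have k2 : 0 < k ^+ 2 by rewrite exprn_even_gt0.
have sk : 0 < s * k ^+ 2 by rewrite mulr_gt0.
nra.
Qed.

(** Moving from [p] along [v] leaves the active constraints at equality, and a short move keeps the
    others satisfied, so [p] is free to move both ways. *)
Lemma is_proj_polyhedral_active (m : nat) (a : 'I_m -> V) (beta : 'I_m -> R)
    (x p v : V) :
  is_proj [set y | forall i, ip (a i) y <= beta i] x p ->
  (forall i, ip (a i) p = beta i -> ip (a i) v = 0) -> ip (x - p) v = 0.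
Proof.
move=> pp act.
pose s i := beta i - ip (a i) p.
have s0 i : 0 <= s i by rewrite subr_ge0; exact: pp.1.
(* Each inactive constraint stays slack for small [t]. *)
pose f i := if s i == 0 then 1 else s i / (1 + `|ip (a i) v|).
have d0 i : 0 < 1 + `|ip (a i) v| by rewrite ltr_pwDl.
have f0 i : 0 < f i.
  rewrite /f; case: eqVneq => // si.
  by rewrite divr_gt0// lt_def si s0.
apply: (is_proj_ip_eq0 _ _ _ _ (\big[Num.min/1]_i f i) pp) => [|t ht i].
  by apply: lt_bigmin.
have tf : `|t| <= f i by rewrite (le_trans ht)// bigmin_le_cond.
rewrite /= ipDr ipZr.
have [/eqP|si] := eqVneq (s i) 0.
  by rewrite subr_eq0 => /eqP si; rewrite act// mulr0 addr0 -si.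
move: tf; rewrite /f (negbTE si) ler_pdivlMr// => tf.
have : t * ip (a i) v <= `|t| * `|ip (a i) v|.
  by rewrite -normrM ler_norm.
by move: tf; rewrite mulrDr mulr1 {1}/s; have := normr_ge0 t; lra.
Qed.

(** * Kernels of finite constraint families and the angles between them *)

Section Family.
Context (I : finType) (a : I -> V).

Definition ker (A : {pred I}) (v : V) := forall i, i \in A -> ip (a i) v = 0.

Lemma kerB A u v : ker A u -> ker A v -> ker A (u - v).
Proof. by move=> hu hv i iA; rewrite ipBr hu// hv// subr0. Qed.

(** Gram-Schmidt with an error bound: on the kernel of [s], [a j] acts as its projection [b], so
    adding the constraint [j] means removing the component along [b]. *)
Lemma ker_proj_seq (s : seq I) : exists2 K : R, 0 <= K &
  forall x, exists p, [/\ ker (mem s) p,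
    forall v, ker (mem s) v -> ip (x - p) v = 0 &
    `|x - p| <= K * \sum_(i <- s) `|ip (a i) x| ].
Proof.
elim: s => [|j s [K K0 projs]].
  exists 0 => // x; exists x; split => // [v _|].
    by rewrite subrr ip0l.
  by rewrite subrr normr0 mul0r.
have [b [sb jb _]] := projs (a j).
have kcons v : ker (mem (j :: s)) v -> ker (mem s) v /\ ip (a j) v = 0.
  move=> h; split; last by apply: h; rewrite inE eqxx.
  by move=> i /= si; apply: h; rewrite inE; apply/orP; right.
have consk v : ker (mem s) v -> ip (a j) v = 0 -> ker (mem (j :: s)) v.
  by move=> h jv i; rewrite inE => /orP[/eqP->|/h].
have jE v : ker (mem s) v -> ip (a j) v = ip b v.
  by move=> /jb; rewrite ipBl; lra.
exists (K + (1 + `|a j| * K) / `|b|).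
  by rewrite addr_ge0// divr_ge0// addr_ge0// mulr_ge0.
move=> x; have [p [sp xp np]] := projs x.
rewrite big_cons; set S := \sum_(i <- s) _ in np *.
have S0 : 0 <= S by apply: sumr_ge0.
have jx0 : 0 <= `|ip (a j) x| by [].
(* If [b = 0], the constraint [j] already holds on the kernel of [s]; division by zero then gives
   [t = 0], and no correction is made. *)
pose t := ip (a j) p / `|b| ^+ 2.
exists (p - t *: b); split.
- apply: consk => [i si|]; first by rewrite ipBr ipZr sp// sb// mulr0 subr0.
  rewrite ipBr ipZr [ip _ b]jE// ipxx /t.
  have [b0|b0] := eqVneq b 0; last by rewrite divfK ?subrr// sqrf_eq0 normr_eq0.
  by rewrite jE// b0 ip0l mul0r mul0r subr0.
- move=> v /kcons[sv jv].
  by rewrite opprB addrCA addrC ipDl xp// ipZl -jE// jv mulr0 addr0.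
- have tb : `|t *: b| <= (`|ip (a j) x| + `|a j| * (K * S)) / `|b|.
    rewrite normrZ /t normrM normfV normrX normr_id.
    have [->|b0] := eqVneq b 0; first by rewrite normr0 mulr0 invr0 mulr0.
    have nb : `|b| != 0 by rewrite normr_eq0.
    have -> : `|ip (a j) p| / `|b| ^+ 2 * `|b| = `|ip (a j) p| / `|b|.
      by field.
    rewrite ler_wpM2r ?invr_ge0//.
    have -> : ip (a j) p = ip (a j) x - ip (a j) (x - p) by rewrite ipBr; ring.
    rewrite (le_trans (ler_normB _ _))// lerD2l (le_trans (normr_ip_le _ _))//.
    by rewrite ler_wpM2l.
  rewrite opprB addrCA addrC (le_trans (ler_normD _ _))//.
  rewrite (le_trans (lerD np tb))// -subr_ge0.
  set jx := `|ip (a j) x| in jx0 *.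
  have -> : (K + (1 + `|a j| * K) / `|b|) * (jx + S)
      - (K * S + (jx + `|a j| * (K * S)) / `|b|)
    = K * jx + (S + `|a j| * K * jx) / `|b| by ring.
  by rewrite addr_ge0// ?mulr_ge0// ?invr_ge0// addr_ge0// ?mulr_ge0.
Qed.

Lemma ker_proj : exists2 K : R, 0 <= K &
  forall (S : {set I}) x, exists p, [/\ ker (mem S) p,
    forall v, ker (mem S) v -> ip (x - p) v = 0 &
    `|x - p| <= K * \sum_(i in S) `|ip (a i) x| ].
Proof.
have /choice[K KP] : forall S : {set I}, exists K : R, 0 <= K /\
  forall x, exists p, [/\ ker (mem S) p,
    forall v, ker (mem S) v -> ip (x - p) v = 0 &
    `|x - p| <= K * \sum_(i in S) `|ip (a i) x| ].
  move=> S; have [K K0 h] := ker_proj_seq (enum S); exists K; split=> // x.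
  have memE v : ker (mem (enum S)) v <-> ker (mem S) v.
    by split=> hv i iS; apply: hv; move: iS; rewrite /= mem_enum.
  have [p [ps xp np]] := h x; exists p; split; first exact/memE.
    by move=> v /memE/xp.
  by rewrite big_enum in np.
exists (\sum_(S : {set I}) K S); first by apply: sumr_ge0 => S _; case: (KP S).
move=> S x; have [p [ps xp np]] := (KP S).2 x; exists p; split=> //.
rewrite (le_trans np)// ler_wpM2r ?sumr_ge0//.
by rewrite (bigD1 S)//= lerDl sumr_ge0// => U _; case: (KP U).
Qed.

(* The Friedrichs angle between [ker S] and [ker T] is positive. *)
Lemma ker_angle : exists2 K : R, 1 <= K &
  forall (S T : {set I}) (w d : V), ker (mem S) w -> ker (mem T) (w - d) ->
    (forall v, ker (mem (S :|: T)) v -> ip w v = 0) -> `|w| <= K * `|d|.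
Proof.
have [K K0 KP] := ker_proj.
(* The summand 1 secures [1 <= K], which later yields [g <= 1]. *)
exists (1 + K * \sum_i `|a i|) => [|S T w d Sw Td wN].
  by rewrite lerDl mulr_ge0// sumr_ge0.
(* Since [w] is orthogonal to the kernel of [S :|: T], its projection there is 0 and the residuals
   bound [|w|]; those in [S] vanish, those in [T] equal [ip (a i) d]. *)
have [p [pN wpN np]] := KP (S :|: T) w.
have p0 : p = 0.
  by apply: ipxx_eq0; have := wpN _ pN; rewrite ipBl wN//; lra.
rewrite p0 subr0 in np.
have sle : \sum_(i in S :|: T) `|ip (a i) w| <= (\sum_i `|a i|) * `|d|.
  rewrite mulr_suml [leRHS](bigID (mem (S :|: T)))/=.
  rewrite -[leLHS]addr0 lerD ?sumr_ge0//.
  apply: ler_sum => i; rewrite inE => /orP[iS|iT].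
    by rewrite Sw// normr0 mulr_ge0.
  have := Td i iT; rewrite ipBr => /eqP; rewrite subr_eq0 => /eqP->.
  exact: normr_ip_le.
rewrite (le_trans np)// mulrDl mul1r -mulrA.
by rewrite (le_trans (ler_wpM2l K0 sle))// lerDr.
Qed.

Lemma perp_to_ker_decomp (S : {set I}) (x : V) : exists y,
  [/\ ker (mem S) y, forall v, ker (mem S) v -> ip (x - y) v = 0 &
      `|x| ^+ 2 = `|y| ^+ 2 + `|x - y| ^+ 2].
Proof.
have [_ _ /(_ S x)[y [yS xy _]]] := ker_proj; exists y; split=> //.
by rewrite -pythagoras ?[y + _]addrC ?subrK// ipC xy.
Qed.

(** * The convex body and its invariance under relaxed steps *)

Definition body (r : nat -> R) (x : V) :=
  forall (S : {set I}) u, ker (mem S) u -> ip u x <= r #|S| * `|u|.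

Lemma body_norm_le r x : 0 <= r 0%N -> body r x -> `|x| <= r 0%N.
Proof.
move=> r0 /(_ finset.set0 x); rewrite cards0 ipxx => h.
have [->|x0] := eqVneq x 0; first by rewrite normr0.
rewrite -(@ler_pM2r _ `|x|) ?normr_gt0// -expr2; apply: h => i.
by rewrite /= inE.
Qed.

(** Take [u = y] as the test vector. By Cauchy-Schwarz the converse holds too, so for nonnegative
    radii the body bounds the projections of [x] onto all kernels, by conditions linear in [x]. *)
Lemma body_ker_norm_le r (S : {set I}) x y : 0 <= r #|S| -> body r x ->
  ker (mem S) y -> ip (x - y) y = 0 -> `|y| <= r #|S|.
Proof.
move=> r0 xb yS; rewrite ipBl => /eqP; rewrite subr_eq0 => /eqP xy.
have [->|y0] := eqVneq y 0; first by rewrite normr0.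
rewrite -(@ler_pM2r _ `|y|) ?normr_gt0// -expr2 -ipxx -xy ipC.
exact: xb.
Qed.

Lemma dot2_le (s t y z : R) :
  (s * y + t * z) ^+ 2 <= (s ^+ 2 + t ^+ 2) * (y ^+ 2 + z ^+ 2).
Proof. by have := sqr_ge0 (s * z - t * y); nra. Qed.

(* The overrelaxed step [x |-> x + L (p - x)] acts on [u], up to translation,
   through its self-adjoint linear part: this fixes the component [u1] of
   [u] in [N = ker (S :|: T)] and multiplies the squared norm of
   the rest by at most [1 - g]. *)
Lemma overrelaxed_step_le r (L K beta : R) (S T : {set I}) (x p q u : V) :
  let g := L * (2 - L) / K ^+ 2 in
  1 <= L < 2 -> 1 <= K ->
  (forall w d, ker (mem S) w -> ker (mem T) (w - d) ->
    (forall v, ker (mem (S :|: T)) v -> ip w v = 0) -> `|w| <= K * `|d|) ->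
  (forall k, 0 <= r k) -> L * beta <= r #|S| ->
  (1 - g) * r 0%N ^+ 2 + g * r #|S :|: T| ^+ 2 <= (r #|S| - L * beta) ^+ 2 ->
  body r x -> ker (mem T) (p - q) -> `|q| <= beta ->
  (forall v, ker (mem T) v -> ip (x - p) v = 0) ->
  ker (mem S) u ->
  ip u x + L * ip u (p - x) <= r #|S| * `|u|.
Proof.
move=> g /andP[L1 L2] K1 angle r0 rS rcond xb pqT qbeta xpT uS.
have NS v : ker (mem (S :|: T)) v -> ker (mem S) v.
  by move=> h i iS; apply: h; rewrite inE; apply/orP; left.
have NT v : ker (mem (S :|: T)) v -> ker (mem T) v.
  by move=> h i iT; apply: h; rewrite inE; apply/orP; right.
have [u1 [u1N uu1 nu]] := perp_to_ker_decomp (S :|: T) u.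
have [y [yN xy nx]] := perp_to_ker_decomp (S :|: T) x.
set w := u - u1 in uu1 nu; set z := x - y in xy nx.
have wS : ker (mem S) w by apply: kerB => //; exact: NS.
have [t [tT wt nw]] := perp_to_ker_decomp T w.
set d := w - t in wt nw.
have wdt : w - d = t by rewrite /d opprB addrC subrK.
have wK : `|w| <= K * `|d| by apply: angle; rewrite ?wdt.
have yr := body_ker_norm_le _ _ _ _ (r0 _) xb yN (xy _ yN).
have xr := body_norm_le _ _ (r0 _) xb.
(* The image of [w] under the linear part of the step: its squared norm is that of [w] minus
   [L * (2 - L) * |d| ^+ 2], and the angle bound turns this loss into the factor [1 - g]. *)
pose e := w - L *: d.
have wd : ip w d = `|d| ^+ 2.
  by rewrite -ipxx -[w](subrK t) -/d ipDl [ip t d]ipC (wt _ tT) addr0.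
have K20 : 0 < K ^+ 2 by rewrite exprn_gt0// (lt_le_trans ltr01).
have ne : `|e| ^+ 2 <= (1 - g) * `|w| ^+ 2.
  rewrite norm_sub_scale wd.
  have : `|w| ^+ 2 <= K ^+ 2 * `|d| ^+ 2.
    by rewrite -exprMn ler_sqr ?nnegrE// mulr_ge0// (le_trans ler01).
  rewrite -ler_pdivrMl// => h.
  have -> : (1 - g) * `|w| ^+ 2
      = `|w| ^+ 2 - L * (2 - L) * ((K ^+ 2)^-1 * `|w| ^+ 2) by rewrite /g; ring.
  have LL : 0 <= L * (2 - L) by nra.
  by have := ler_wpM2l LL h; lra.
have dw : `|d| <= `|w| by rewrite -ler_sqr ?nnegrE//; have := sqr_ge0 `|t|; lra.
have wu : `|w| <= `|u| by rewrite -ler_sqr ?nnegrE//; have := sqr_ge0 `|u1|; lra.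
(* As [p - x] is orthogonal to the kernel of [T], only the part [d] of [u] sees it; as [d] is
   orthogonal to [p - q], the point [p] may be replaced by [q]. *)
have stepE : ip u x + L * ip u (p - x)
    = ip u1 y + ip e z + L * ip d q.
  have hu1 : ip u1 (p - x) = 0.
    rewrite -opprB -scaleN1r ipZr ipC xpT ?mulr0//; exact: NT.
  have htp : ip t (p - x) = 0.
    by rewrite -opprB -scaleN1r ipZr ipC xpT ?mulr0.
  have hdp : ip d (p - q) = 0 by rewrite wt.
  have hzu : ip u1 z = 0 by rewrite ipC xy.
  have hwy : ip w y = 0 by rewrite uu1.
  have hdy : ip d y = 0 by rewrite wt//; exact: NT.
  have uE : u = w + u1 by rewrite subrK.
  have xE : x = z + y by rewrite subrK.
  have wE : w = d + t by rewrite subrK.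
  rewrite /e; clear e ne; clearbody d z w.
  have -> : ip u x = ip u1 y + ip w z.
    by rewrite uE xE !ipDl !ipDr hwy hzu addr0 add0r addrC.
  have -> : ip u (p - x) = ip d q - ip d z.
    rewrite uE ipDl hu1 wE ipDl htp !addr0 xE.
    have -> : p - (z + y) = (p - q) + (q - (z + y)) by rewrite addrA subrK.
    by rewrite ipDr hdp add0r ipBr ipDr hdy addr0.
  by rewrite ipBl ipZl; ring.
rewrite stepE.
have dq : ip d q <= beta * `|u|.
  rewrite (le_trans (ip_le_norm _ _))// mulrC ler_pM//.
  exact: le_trans dw wu.
have g0 : 0 <= g by rewrite divr_ge0 ?(ltW K20)//; nra.
have g1 : 0 <= 1 - g.
  rewrite subr_ge0 ler_pdivrMr// mul1r.
  have : 1 <= K ^+ 2 by rewrite exprn_ege1.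
  by have := sqr_ge0 (L - 1); nra.
(* With [|z| ^+ 2 = |x| ^+ 2 - |y| ^+ 2] the left side becomes a convex combination of [|x| ^+ 2]
   and [|y| ^+ 2], both controlled by the body. *)
have quad : `|y| ^+ 2 + (1 - g) * `|z| ^+ 2 <= (r #|S| - L * beta) ^+ 2.
  rewrite (le_trans _ rcond)//.
  have x2 : `|x| ^+ 2 <= r 0%N ^+ 2 by rewrite ler_sqr ?nnegrE.
  have y2 : `|y| ^+ 2 <= r #|S :|: T| ^+ 2 by rewrite ler_sqr ?nnegrE.
  rewrite (le_trans _ (lerD (ler_wpM2l g1 x2) (ler_wpM2l g0 y2)))//.
  by rewrite nx; lra.
have mainb : ip u1 y + ip e z <= (r #|S| - L * beta) * `|u|.
  have B0 : 0 <= r #|S| - L * beta by rewrite subr_ge0.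
  have A0 : 0 <= (r #|S| - L * beta) * `|u| by rewrite mulr_ge0.
  have es : `|e| <= Num.sqrt (1 - g) * `|w|.
    by rewrite -ler_sqr ?nnegrE ?mulr_ge0 ?sqrtr_ge0// exprMn sqr_sqrtr.
  have le1 : ip u1 y + ip e z
      <= `|u1| * `|y| + `|w| * (Num.sqrt (1 - g) * `|z|).
    rewrite lerD ?ip_le_norm// (le_trans (ip_le_norm _ _))//.
    by rewrite mulrCA mulrA ler_wpM2r.
  apply: (le_trans le1).
  have P0 : 0 <= `|u1| * `|y| + `|w| * (Num.sqrt (1 - g) * `|z|).
    by rewrite addr_ge0// !mulr_ge0// sqrtr_ge0.
  rewrite -ler_sqr ?nnegrE//.
  apply: (le_trans (dot2_le _ _ _ _)).
  by rewrite -nu [leRHS]exprMn mulrC ler_wpM2r ?sqr_ge0// exprMn sqr_sqrtr.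
rewrite (le_trans (lerD mainb (ler_wpM2l _ dq)))//; last by lra.
by rewrite (le_trans ler01).
Qed.

Lemma relaxed_step_body r (L K beta mu : R) (T : {set I}) (x p q : V) :
  let g := L * (2 - L) / K ^+ 2 in
  1 <= L < 2 -> 1 <= K ->
  (forall (S T : {set I}) w d, ker (mem S) w -> ker (mem T) (w - d) ->
    (forall v, ker (mem (S :|: T)) v -> ip w v = 0) -> `|w| <= K * `|d|) ->
  (forall k, 0 <= r k) -> (forall k, L * beta <= r k) ->
  (forall k j, (k < j <= #|I|)%N ->
    (1 - g) * r 0%N ^+ 2 + g * r j ^+ 2 <= (r k - L * beta) ^+ 2) ->
  body r x -> ker (mem T) (p - q) -> `|q| <= beta ->
  (forall v, ker (mem T) v -> ip (x - p) v = 0) ->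
  0 <= mu <= L -> body r ((1 - mu) *: x + mu *: p).
Proof.
move=> g L12 K1 angle r0 rL rcond xb pqT qbeta xpT /andP[mu0 muL] S u uS.
have -> : (1 - mu) *: x + mu *: p = x + mu *: (p - x).
  by rewrite scalerBl scale1r scalerBr addrAC -addrA.
rewrite ipDr ipZr.
have xu := xb S u uS.
have [TS|/negP TS] := boolP (T \subset S).
  have uT : ker (mem T) u by move=> i iT; apply: uS; exact: (fintype.subsetP TS).
  by rewrite -opprB -scaleN1r ipZr [ip u (x - p)]ipC xpT// !mulr0 addr0.
have cardST : (#|S| < #|S :|: T| <= #|I|)%N.
  rewrite max_card andbT proper_card// finset.properEneq finset.subsetUl andbT.
  by apply/eqP => h; apply: TS; rewrite h finset.subsetUr.
have := overrelaxed_step_le _ _ _ _ _ _ _ _ _ _ L12 K1 (angle S T) r0 (rL _)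
  (rcond _ _ cardST) xb pqT qbeta xpT uS.
(* The value is affine in [mu]: a nonnegative slope is compared with [mu = L], a negative one with
   [mu = 0]. *)
by move=> h; have [h0|h0] := leP 0 (ip u (p - x)); nra.
Qed.

(** The radii are [rho * sqrt (1 - dl k)] with [dl] growing so fast that [2 * dl k <= g * dl j] for
    [k < j]. Of the gain [2 * dl k], one half makes up the deficit [dl k], the other absorbs the
    translation [B] once [rho] is large. *)
Lemma body_radii (g B c : R) (m : nat) : 0 < g <= 1 -> 0 <= B -> 0 <= c ->
  exists r : nat -> R, [/\ forall k, B <= r k, forall k, c <= r k &
    forall k j, (k < j <= m)%N ->
      (1 - g) * r 0%N ^+ 2 + g * r j ^+ 2 <= (r k - B) ^+ 2].
Proof.
move=> /andP[g0 g1] B0 c0.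
pose h := g / 2; have h0 : 0 < h by rewrite /h; lra.
have h12 : h <= 2^-1 by rewrite /h; lra.
(* Truncated subtraction makes [dl] constant from [k = m] on, so the lower bounds on the radii hold
   for every [k]. *)
pose dl k := h ^+ (m - k).+1.
have dl0 k : 0 < dl k by rewrite exprn_gt0.
have dl12 k : dl k <= 2^-1.
  rewrite /dl exprS (le_trans _ h12)// ler_piMr ?(ltW h0)//.
  by rewrite exprn_ile1 ?(ltW h0)// (le_trans h12)//; lra.
have dlS k j : (k < j <= m)%N -> 2 * dl k <= g * dl j.
  move=> /andP[kj jm].
  have -> : g = 2 * h by rewrite /h; field.
  rewrite -mulrA ler_pM2l// /dl -exprS ler_wiXn2l ?(ltW h0)//.
    by rewrite (le_trans h12)//; lra.
  by rewrite ltnS ltn_sub2l// (leq_trans kj).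
pose d0 := h ^+ m.+1.
have d00 : 0 < d0 by rewrite exprn_gt0.
have d0k k : d0 <= dl k.
  rewrite /d0 /dl ler_wiXn2l ?(ltW h0)//; last by rewrite ltnS leq_subr.
  by rewrite (le_trans h12)//; lra.
(* As [d0] is the least [dl k], [rho * dl k] is at least [2 * (B + c)] for all [k]. *)
pose rho := 2 * (B + c) / d0.
have rhod : rho * d0 = 2 * (B + c) by rewrite /rho divfK// gt_eqF.
have rho0 : 0 <= rho by rewrite divr_ge0 ?(ltW d00)// mulr_ge0// addr_ge0.
have rhodl k : 2 * (B + c) <= rho * dl k by rewrite -rhod ler_wpM2l.
pose q k := Num.sqrt (1 - dl k).
have q2 k : q k ^+ 2 = 1 - dl k.
  by rewrite sqr_sqrtr// subr_ge0 (le_trans (dl12 k))//; lra.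
have q0 k : 0 <= q k by exact: sqrtr_ge0.
have q12 k : 2^-1 <= q k.
  by rewrite -ler_sqr ?nnegrE// q2; have := dl12 k; lra.
have q1 k : q k <= 1 by have := q2 k; have := dl0 k; nra.
have rBc k : B + c <= rho * q k.
  have := rhodl k; have := dl12 k; have := q12 k; have := dl0 k; nra.
exists (fun k => rho * q k); split=> [k|k|k j kj].
- by have := rBc k; lra.
- by have := rBc k; lra.
- have rq2 i : (rho * q i) ^+ 2 = rho ^+ 2 * (1 - dl i).
    by rewrite -q2; ring.
  have -> : (rho * q k - B) ^+ 2
    = (rho * q k) ^+ 2 - 2 * B * (rho * q k) + B ^+ 2 by ring.
  rewrite !rq2.
  have hk := rhodl k.
  have t1 : rho * (2 * dl k) <= rho * (g * dl j) by rewrite ler_wpM2l// dlS.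
  have t2 : rho * (rho * (2 * dl k)) <= rho * (rho * (g * dl j)).
    by rewrite ler_wpM2l.
  have t3 : 2 * B * (rho * q k) <= 2 * B * rho.
    by rewrite ler_wpM2l ?mulr_ge0// ler_piMr.
  have t4 : 2 * B * rho <= rho * dl k * rho by rewrite ler_wpM2r//; lra.
  have t5 : 0 <= rho ^+ 2 * ((1 - g) * dl 0%N).
    by rewrite mulr_ge0 ?sqr_ge0// mulr_ge0 ?(ltW (dl0 _))//; lra.
  have t6 := sqr_ge0 B.
  lra.
Qed.

(** * Boundedness of the iterates *)

Lemma relaxed_affine_projections_bounded (b : I -> R) (lambda : R)
    (x : nat -> V) :
  0 <= lambda < 2 ->
  (forall n, exists (T : {set I}) (mu : R) (p : V),
     [/\ 0 <= mu <= lambda, forall i, i \in T -> ip (a i) p = b i,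
         forall v, ker (mem T) v -> ip (x n - p) v = 0 &
         x n.+1 = (1 - mu) *: x n + mu *: p]) ->
  exists M : R, forall n, `|x n| <= M.
Proof.
move=> /andP[l0 l2] step.
(* Enlarging the parameter range keeps [g] positive even for [lambda = 0]. *)
pose L := Num.max lambda 1.
have L12 : 1 <= L < 2 by rewrite le_max lexx orbT/= gt_max l2/=; lra.
have lL : lambda <= L by rewrite le_max lexx.
have [K K1 angle] := ker_angle.
pose g := L * (2 - L) / K ^+ 2.
have g01 : 0 < g <= 1.
  have K2 : 1 <= K ^+ 2 by rewrite exprn_ege1.
  have K20 : 0 < K ^+ 2 by rewrite (lt_le_trans ltr01).
  case/andP: L12 => L1 L2.
  rewrite divr_gt0//=; last by nra.
  by rewrite ler_pdivrMr// mul1r; have := sqr_ge0 (L - 1); nra.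
(* One reference point per consistent system, so that [beta] bounds all translations; the
   placeholder 0 serves inconsistent systems, which no step uses. *)
have /choice[q qP] : forall T : {set I}, exists q, forall p,
    (forall i, i \in T -> ip (a i) p = b i) ->
    forall i, i \in T -> ip (a i) q = b i.
  move=> T.
  have [[q hq]|no] := pselect (exists q, forall i, i \in T -> ip (a i) q = b i).
    by exists q.
  by exists 0 => p hp; case: no; exists p.
pose beta := \sum_T `|q T|.
have qbeta T : `|q T| <= beta.
  by rewrite /beta (bigD1 T)//= lerDl sumr_ge0.
have beta0 : 0 <= beta by exact: sumr_ge0.
have L0 : 0 <= L by case/andP: L12; lra.
(* Radii of at least the norm of [x 0] put the starting point in the body. *)
have [r [rB rx rcond]] :=
  body_radii g (L * beta) `|x 0%N| #|I| g01 (mulr_ge0 L0 beta0) (normr_ge0 _).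
have r0 k : 0 <= r k by exact: le_trans (rx k).
exists (r 0%N) => n; apply: body_norm_le => //.
elim: n => [|n IHn].
  move=> S u _; rewrite (le_trans (ip_le_norm _ _))// mulrC.
  by rewrite ler_wpM2r.
have [T [mu [p [/andP[mu0 mul] pT xpT ->]]]] := step n.
apply: (relaxed_step_body _ _ _ _ _ T _ _ (q T) L12 K1 angle r0 rB rcond) => //.
  by move=> i iT; rewrite ipBr pT// (qP T p)// subrr.
by rewrite mu0 (le_trans mul).
Qed.

End Family.
(** Pooling all constraints into one finite family leaves finitely many active sets, hence constants
    independent of the step. *)
Lemma common_constraints (Cs : seq (set V)) :
  (forall C, C \in Cs -> polyhedral ip C) ->
  exists (I : finType) (a : I -> V) (b : I -> R),
    forall C, C \in Cs -> exists (m : nat) (f : 'I_m -> I),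
      C = [set x | forall i, ip (a (f i)) x <= b (f i)].
Proof.
elim: Cs => [|C Cs IH] Cpoly.
  by exists void, (fun i : void => match i with end),
    (fun i : void => match i with end).
have [D DCs|I [a [b ab]]] := IH.
  by apply: Cpoly; rewrite inE DCs orbT.
have [|m [a' [b' [_ CE]]]] := Cpoly C; first by rewrite inE eqxx.
exists ('I_m + I)%type,
  (fun i => match i with inl j => a' j | inr j => a j end),
  (fun i => match i with inl j => b' j | inr j => b j end) => D.
rewrite inE => /orP[/eqP->|/ab[k [f DE]]]; first by exists m, inl.
by exists k, (fun j => inr (f j)).
Qed.

End InnerProduct.

Theorem theorem3p2 (R : realType) (V : completeNormedModType R)
    (ip : V -> V -> R) (Cs : seq (set V)) (lambda : R) (x : nat -> V) :
  is_inner_product ip ->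
  Cs != [::] ->
  (forall C, C \in Cs -> polyhedral ip C /\ C !=set0) ->
  0 <= lambda < 2 ->
  (forall n : nat, exists C, exists mu : R, exists p : V,
     [/\ C \in Cs, 0 <= mu <= lambda, is_proj C (x n) p &
         x n.+1 = (1 - mu) *: x n + mu *: p]) ->
  exists M : R, forall n : nat, `|x n| <= M.
Proof.
move=> ip_inner _ Cpoly l02 step.
have [I [a [b ab]]] := common_constraints _ _ _ _ (fun C CCs => (Cpoly C CCs).1).
apply: (relaxed_affine_projections_bounded _ _ _ ip_inner _ a b _ _ l02) => n.
have [C [mu [p [/ab[m [f CE]] mul pp xS]]]] := step n; subst C.
(* The constraints of the chosen polyhedron active at [p], as indices in the pooled family. *)
pose T := [set f i | i : 'I_m & ip (a (f i)) p == b (f i)].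
exists T, mu, p; split=> // [j /imsetP[i]|v vT].
  by rewrite inE => /eqP pi ->.
apply: (is_proj_polyhedral_active _ _ _ ip_inner _ _ _ _ _ _ pp) => i /eqP pi.
by apply: vT; apply/imsetP; exists i; rewrite ?inE.
Qed.
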